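(* Let $n$ be an odd integer with $n\ge 931=\lceil 1861/2\rceil$ such that $D=n^2+1$ is squarefree. Then $h(D)>1$.
   Context: For a squarefree integer $D>1$, $h(D)$ denotes the class number of the real quadratic field $\mathbb{Q}(\sqrt D)$. *)

(* Defs.v *)
From mathcomp Require Import all_boot all_order all_algebra all_field.
From mathcomp Require Import finmap.
From mathcomp Require Import boolp classical_sets functions cardinality.

Set Implicit Arguments.
Unset Strict Implicit.
Unset Printing Implicit Defensive.

Import GRing.Theory Num.Theory.
Local Open Scope classical_set_scope.
Local Open Scope ring_scope.

Definition squarefree (m : nat) : Prop :=
  forall d : nat, (d ^ 2 %| m)%N -> d = 1%N.

(* Number fields are represented by their images in algC, as sets K. *)

Definition ring_of_integers (K : set algC) : set algC :=
  [set x | K x /\ x \in Aint].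

Definition is_fractional_ideal (K I : set algC) : Prop :=
  [/\ I `<=` K,
      exists2 x, I x & x != 0,
      forall x y, I x -> I y -> I (x + y),
      forall a x, ring_of_integers K a -> I x -> I (a * x)
    & exists2 d, ring_of_integers K d /\ d != 0
               & forall x, I x -> ring_of_integers K (d * x)].

(* The coset of the fractional ideal I modulo the principal fractional ideals:
   the product of I with the principal fractional ideal generated by c is
   c I. *)
Definition ideal_class (K I : set algC) : set (set algC) :=
  [set J | exists2 c, K c /\ c != 0 & J = [set c * x | x in I]].

Definition class_group (K : set algC) : set (set (set algC)) :=
  [set ideal_class K I | I in is_fractional_ideal K].

(* fset_set sends an infinite set to the empty finite set, so a positive class
   number entails that the class group is finite. *)
Definition class_number (K : set algC) : nat := #|` fset_set (class_group K)|.

Definition quadratic_field (D : nat) : set algC :=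
  [set x | exists a b : rat, x = ratr a + ratr b * sqrtC D%:R].

Definition h (D : nat) : nat := class_number (quadratic_field D).

(* Main.v *)
Require Import Defs.
From mathcomp Require Import all_boot all_order all_algebra all_field.
From mathcomp Require Import finmap.
From mathcomp Require Import boolp classical_sets functions cardinality.
From mathcomp Require Import ring lra zify.

(* Write D = n^2 + 1, so that D = 2 mod 4 and Z[sqrt D] is the ring of integers.
   The ideal (2, sqrt D) is not principal: the norm of a generator would be 2 or
   -2, and descent by the unit n + sqrt D excludes both.

   The class number counts an infinite class group as 0, so finiteness is
   needed too.  Let beta be an element of minimal nonzero norm of an integral
   ideal I.  By Dirichlet approximation, for each alpha in I some multiple
   t alpha with 1 <= t <= D lies within norm < |N(beta)| of O beta, hence in
   O beta.  So D! I / beta is an integral ideal that contains D!, and only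
   finitely many ideals do. *)

Set Implicit Arguments.
Unset Strict Implicit.
Unset Printing Implicit Defensive.

Section RealQuadraticFields.
Import Order.TTheory GRing.Theory Num.Theory.
Local Open Scope classical_set_scope.
Local Open Scope ring_scope.

(** * Integer tools: integrality of rationals, Pell descent, Dirichlet approximation *)

Lemma squarefree_mul_sqr_int (D : nat) (q : rat) (m : int) :
  squarefree D -> D%:R * q ^+ 2 = m%:~R -> q \is a Num.int.
Proof.
move=> D_sqf qm.
have d0 : (denq q)%:~R != 0 :> rat by rewrite intr_eq0 denq_eq0.
have e : D%:Z * numq q ^+ 2 = m * denq q ^+ 2.
  apply: (@intr_inj rat); rewrite !rmorphM /= -qm numqE; ring.
(* The squared denominator is prime to the squared numerator, so it divides [D]. *)
have : (denq q ^+ 2 %| D%:Z)%Z.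
  have : (denq q ^+ 2 %| D%:Z * numq q ^+ 2)%Z by rewrite e dvdz_mull.
  rewrite Gauss_dvdzl // coprimezE !abszX coprimeXl // coprimeXr //.
  by rewrite coprime_sym coprime_num_den.
rewrite dvdzE abszX /= => /D_sqf d1.
by rewrite Qint_def -(gez0_abs (denq_ge0 q)) d1.
Qed.

(* Descent: multiplying x + y sqrt(n^2+1) by the unit -n + sqrt(n^2+1) changes
   the sign of the norm and decreases y. *)
Lemma pell_neq2 (n : nat) (x y : int) :
  (1 < n)%N -> `|x ^+ 2 - (n ^ 2 + 1)%N%:Z * y ^+ 2| != 2.
Proof.
move=> n_gt1; have [k] := ubnP `|y|%N; elim: k x y => // k IH x y ltyk.
have -> : (n ^ 2 + 1)%N%:Z = n%:Z ^+ 2 + 1 by lia.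
wlog x0 : x / 0 <= x => [th|].
  by case: (leP 0 x) => hx; [exact: th | rewrite -sqrrN th // oppr_ge0 ltW].
wlog y0 : y ltyk / 0 <= y => [th|].
  case: (leP 0 y) => hy; first exact: th.
  by rewrite -(sqrrN y) th ?abszN // oppr_ge0 ltW.
apply/eqP => e2.
case: (leP y 1) => y1.
  have [y_0|y_1] : y = 0 \/ y = 1 by lia.
    move: e2; rewrite y_0 expr0n mulr0 subr0 => e2.
    have [x1|x2] : x <= 1 \/ 2 <= x by lia.
      by nia.
    by nia.
  move: e2; rewrite y_1 expr1n mulr1 => e2.
  have [|[|]] : x <= n%:Z - 1 \/ x = n%:Z \/ n%:Z + 1 <= x by lia.
  - by nia.
  - by move=> xn; move: e2; rewrite xn; lia.
  - by nia.
(* For [y >= 2], a norm of absolute value 2 forces [n y < x < (n + 1) y], so the new second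
   coordinate lies strictly between 0 and [y]. *)
have xny : n%:Z * y < x by nia.
have lty : x - n%:Z * y < y by nia.
have /negP[] := IH ((n%:Z ^+ 2 + 1) * y - n%:Z * x) (x - n%:Z * y) ltac:(lia).
have -> : (n ^ 2 + 1)%N%:Z = n%:Z ^+ 2 + 1 by lia.
rewrite -e2 -[X in _ == X]normrN; apply/eqP; congr Num.norm; ring.
Qed.

(** Pigeonhole: the residues modulo [N] of the [M + 1] multiples [t b] with [0 <= t <= M] fall into
    [M] intervals of length [N / M]. Two in the same interval are subtracted. *)
Lemma dirichlet_approx (N b : int) (M : nat) : (0 < M)%N -> 0 < N ->
  exists (t : nat) (k : int), (0 < t <= M)%N /\ `|t%:Z * b - k * N| * M%:Z < N.
Proof.
move=> M_gt0 N_gt0.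
have ltM (t : int) : (`|(t * b %% N)%Z * M%:Z %/ N|%Z < M)%N.
  have := modz_ge0 (t * b) (lt0r_neq0 N_gt0).
  have := ltz_pmod (t * b) N_gt0.
  move: (_ %% _)%Z => r rN r0.
  have q0 : 0 <= (r * M%:Z %/ N)%Z by rewrite divz_ge0 // mulr_ge0.
  rewrite -ltz_nat gez0_abs // ltz_divLR // mulrC ltr_pM2l //.
pose f (t : 'I_M.+1) : 'I_M := Ordinal (ltM t).
have /injectivePn[i [j ij /(congr1 val)/= fij]] : ~~ injectiveb f.
  by apply/injectiveP => /leq_card; rewrite !card_ord ltnn.
wlog lt_ij : i j ij fij / (i < j)%N => [th|].
  have [|lt_ji] := ltnP i j; first exact: th.
  by apply: (th j i); rewrite // 1?eq_sym // ltn_neqAle eq_sym ij.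
exists (j - i)%N, ((j%:Z * b %/ N)%Z - (i%:Z * b %/ N)%Z).
have lejM := ltn_ord j; split; first by lia.
have q_ge0 (t : int) : 0 <= ((t * b %% N)%Z * M%:Z %/ N)%Z.
  by rewrite divz_ge0 // mulr_ge0 // modz_ge0 // gt_eqF.
have {}fij : ((i%:Z * b %% N)%Z * M%:Z %/ N)%Z = ((j%:Z * b %% N)%Z * M%:Z %/ N)%Z.
  by rewrite -[LHS]gez0_abs // -[RHS]gez0_abs // fij.
set ri := (i%:Z * b %% N)%Z in fij *; set rj := (j%:Z * b %% N)%Z in fij *.
have -> : (j - i)%N%:Z * b - ((j%:Z * b %/ N)%Z - (i%:Z * b %/ N)%Z) * N = rj - ri.
  have := divz_eq (j%:Z * b) N; have := divz_eq (i%:Z * b) N.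
  rewrite -/ri -/rj -subzn 1?ltnW //; lia.
have := divz_eq (rj * M%:Z) N; have := divz_eq (ri * M%:Z) N.
have := ltz_pmod (ri * M%:Z) N_gt0; have := ltz_pmod (rj * M%:Z) N_gt0.
have := modz_ge0 (ri * M%:Z) (lt0r_neq0 N_gt0).
have := modz_ge0 (rj * M%:Z) (lt0r_neq0 N_gt0).
rewrite fij -[X in `|_| * X](@gez0_abs M%:Z) // abszE -normrM mulrBl ltr_norml.
lia.
Qed.

(** * The field Q(sqrt D) and its ring of integers *)

Section QuadraticField.
Variable D : nat.
Hypothesis D_sqf : squarefree D.
(** [D] is 2 or 3 modulo 4, the case in which the integers of [K] are Z[sqrt D]. This also excludes
    [D = 0] and [D = 1]. *)
Hypothesis D_mod4 : (1 < D %% 4)%N.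

Local Notation K := (quadratic_field D).
Local Notation O := (ring_of_integers K).

Definition qelt (a b : rat) : algC := ratr a + ratr b * sqrtC D%:R.

Lemma qelt0E a : qelt a 0 = ratr a.
Proof. by rewrite /qelt rmorph0 mul0r addr0. Qed.

Lemma qeltD a b c d : qelt a b + qelt c d = qelt (a + c) (b + d).
Proof. rewrite /qelt !rmorphD /=; ring. Qed.

Lemma qeltB a b c d : qelt a b - qelt c d = qelt (a - c) (b - d).
Proof. rewrite /qelt !rmorphB /=; ring. Qed.

Lemma qeltM a b c d :
  qelt a b * qelt c d = qelt (a * c + D%:R * b * d) (a * d + b * c).
Proof.
rewrite /qelt !rmorphD !rmorphM /= rmorph_nat.
rewrite -[X in _ = _ + X * _ * _ + _](sqrtCK (D%:R : algC)); ring.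
Qed.

(** Irrationality of sqrt D: if [b != 0], the vanishing norm gives [D (b / a)^2 = 1], so [b / a] is
    an integer and [D = 1]. *)
Lemma qelt_eq0 a b : qelt a b = 0 -> a = 0 /\ b = 0.
Proof.
have [->|b0] := eqVneq b 0.
  by rewrite qelt0E => /eqP; rewrite fmorph_eq0 => /eqP ->.
move=> ab0.
have : qelt a b * qelt a (- b) = 0 by rewrite ab0 mul0r.
rewrite qeltM (_ : a * - b + b * a = 0); last by ring.
rewrite qelt0E => /eqP; rewrite fmorph_eq0 => /eqP ab2.
have D0 : D%:R != 0 :> rat by rewrite pnatr_eq0; case: (D) D_mod4.
have a0 : a != 0.
  apply: contraNneq b0 => a0; move: ab2; rewrite a0 mul0r add0r mulrN => /eqP.
  by rewrite oppr_eq0 -mulrA !mulf_eq0 orbb (negPf D0).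
have e : D%:R * (b / a) ^+ 2 = 1%:~R.
  have {}ab2 : D%:R * b ^+ 2 = a ^+ 2.
    by apply/eqP; rewrite -subr_eq0 -oppr_eq0 -ab2; apply/eqP; ring.
  by rewrite expr_div_n mulrA ab2 divff // expf_neq0.
have /intrP[k kE] := squarefree_mul_sqr_int D_sqf e.
have /eqP : (D%:Z * k ^+ 2)%:~R = 1%:~R :> rat.
  by rewrite !rmorphM /= -kE.
rewrite eqr_int => /eqP/(congr1 absz); rewrite abszM => /eqP.
by rewrite muln_eq1 => /andP[/eqP/= D1]; move: D_mod4; rewrite D1.
Qed.

Lemma qelt_inj a b c d : qelt a b = qelt c d -> a = c /\ b = d.
Proof.
move/eqP; rewrite -subr_eq0 qeltB => /eqP/qelt_eq0[/eqP + /eqP].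
by rewrite !subr_eq0 => /eqP-> /eqP->.
Qed.

(** Stands in for the automorphism sqrt D -> - sqrt D: conjugate elements are roots of the same
    rational polynomials. *)
Lemma horner_qelt (p : {poly rat}) a b : exists A B,
  (map_poly ratr p).[qelt a b] = qelt A B /\
  (map_poly ratr p).[qelt a (- b)] = qelt A (- B).
Proof.
elim/poly_ind: p => [|p c [A [B [e1 e2]]]].
  by exists 0, 0; rewrite rmorph0 !horner0 oppr0 qelt0E rmorph0.
exists (A * a + D%:R * B * b + c), (A * b + B * a).
rewrite rmorphD rmorphM /= map_polyX map_polyC !hornerE e1 e2 /=.
rewrite -(qelt0E c) !qeltM !qeltD.
by split => //; congr qelt; ring.
Qed.

Lemma qelt_conj_Aint a b : qelt a b \in Aint -> qelt a (- b) \in Aint.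
Proof.
move=> int_ab; have [p [pE p_mon] _] := minCpolyP (qelt a b).
have [A [B [e1 e2]]] := horner_qelt p a b.
have /rootP := root_minCpoly (qelt a b).
rewrite pE e1 => /qelt_eq0[A0 B0].
apply: (@root_monic_Aint (minCpoly (qelt a b))) => //; last exact: minCpoly_monic.
by apply/rootP; rewrite pE e2 A0 B0 oppr0 qelt0E rmorph0.
Qed.

Lemma ratr_Aint (a : rat) : (ratr a : algC) \in Aint -> a \is a Num.int.
Proof.
move=> int_a.
have /intrP[m /eqP] : (ratr a : algC) \in Num.int.
  by apply: Cint_rat_Aint => //; apply/CratP; exists a.
by rewrite -ratr_int (inj_eq (fmorph_inj _)) => /eqP->; apply: intr_int.
Qed.

(** The trace [A = 2 a] and the norm are integers, hence so is [B = 2 b], as [D] is squarefree. Then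
    [A^2 = D B^2] modulo 4, and [D] being 2 or 3 modulo 4 forces [A] and [B] to be even. *)
Lemma qelt_Aint a b :
  qelt a b \in Aint -> a \is a Num.int /\ b \is a Num.int.
Proof.
move=> int_ab; have int_c := qelt_conj_Aint int_ab.
have /intrP[A AE] : 2 * a \is a Num.int.
  apply: ratr_Aint; have := rpredD int_ab int_c.
  by rewrite qeltD subrr qelt0E mulr_natl mulr2n.
have /intrP[N NE] : a ^+ 2 - D%:R * b ^+ 2 \is a Num.int.
  apply: ratr_Aint; have := rpredM int_ab int_c.
  rewrite qeltM (_ : a * - b + b * a = 0); last by ring.
  by rewrite qelt0E (_ : a * a + D%:R * b * - b = a ^+ 2 - D%:R * b ^+ 2) //; ring.
have /intrP[B BE] : 2 * b \is a Num.int.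
  apply: (@squarefree_mul_sqr_int _ _ (A ^+ 2 - 4 * N) D_sqf).
  rewrite rmorphB !rmorphM /= -AE -NE; ring.
have /eqP : (A ^+ 2 - D%:Z * B ^+ 2)%:~R = (4 * N)%:~R :> rat.
  rewrite rmorphB !rmorphM /= -AE -BE -NE; ring.
rewrite eqr_int => /eqP e.
have half (k : int) : exists l, k = 2 * l \/ k = 2 * l + 1.
  by exists (k %/ 2)%Z; lia.
have [A' A'E] := half A; have [B' B'E] := half B.
have [q [r [r23 DE]]] : exists q r : int, (r = 2 \/ r = 3) /\ D = 4 * q + r :> int.
  by exists (D %/ 4)%N, (D %% 4)%N; lia.
have [A2 B2] : A = 2 * A' /\ B = 2 * B'.
  by case: r23 => rE; case: A'E => AE'; case: B'E => BE' //; move: e;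
    rewrite DE rE AE' BE'; lia.
have two0 : 2 != 0 :> rat by [].
split; apply/intrP; [exists A' | exists B']; apply: (mulfI two0).
- by rewrite AE A2 rmorphM.
- by rewrite BE B2 rmorphM.
Qed.

Lemma sqrtC_nat_Aint m : sqrtC m%:R \in Aint.
Proof.
apply: (@root_monic_Aint ('X^2 - (m%:R)%:P)).
- by rewrite rootE !hornerE sqrtCK subrr.
- exact: monicXnsubC.
- apply/polyOverP => i; rewrite coefB coefXn coefC rpredB ?rpred_nat //.
  by case: ifP => _; rewrite ?rpred_nat ?rpred0.
Qed.

Lemma ring_of_integersE :
  O = [set x | exists a b : int, x = qelt a%:~R b%:~R].
Proof.
apply/seteqP; split=> x /=.
  move=> [[a [b ->]] /qelt_Aint[/intrP[c ->] /intrP[d ->]]].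
  by exists c, d.
move=> [a [b ->]]; split; first by exists a%:~R, b%:~R.
by rewrite /qelt !ratr_int rpredD ?rpredM ?Aint_int ?sqrtC_nat_Aint.
Qed.

Lemma quadratic_fieldM x y : K x -> K y -> K (x * y).
Proof.
move=> [a [b ->]] [c [d ->]].
exists (a * c + D%:R * b * d), (a * d + b * c); exact: qeltM.
Qed.

Lemma quadratic_fieldV x : K x -> K x^-1.
Proof.
have [-> //|x0] := eqVneq x 0; first by rewrite invr0.
move=> [a [b xE]]; have {}xE : x = qelt a b by [].
pose N := a ^+ 2 - D%:R * b ^+ 2.
have xN : x * qelt a (- b) = ratr N.
  by rewrite xE qeltM -(qelt0E N) /N; congr qelt; ring.
have c0 : qelt a (- b) != 0.
  apply: contraNneq x0 => /qelt_eq0[a0 /eqP]; rewrite oppr_eq0 => /eqP b0.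
  by rewrite xE a0 b0 qelt0E rmorph0.
have N0 : ratr N != 0 :> algC by rewrite -xN mulf_neq0.
exists (a / N), (- b / N); apply: (mulfI x0).
rewrite divff // -[ratr (a / N) + _]/(qelt _ _).
have -> : qelt (a / N) (- b / N) = qelt a (- b) * ratr N^-1.
  by rewrite -(qelt0E N^-1) qeltM; congr qelt; ring.
by rewrite mulrA xN fmorphV divff.
Qed.

(** * Integer coordinates, norms and approximate division in Z[sqrt D] *)

Definition zelt (a b : int) : algC := qelt a%:~R b%:~R.

Definition znorm (a b : int) : int := a ^+ 2 - D%:Z * b ^+ 2.

Lemma zelt0E (a : int) : zelt a 0 = a%:~R.
Proof. by rewrite /zelt qelt0E ratr_int. Qed.

Lemma zeltD a b c d : zelt a b + zelt c d = zelt (a + c) (b + d).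
Proof. by rewrite /zelt qeltD !rmorphD. Qed.

Lemma zeltB a b c d : zelt a b - zelt c d = zelt (a - c) (b - d).
Proof. by rewrite /zelt qeltB !rmorphB. Qed.

Lemma zeltM a b c d :
  zelt a b * zelt c d = zelt (a * c + D%:Z * b * d) (a * d + b * c).
Proof. by rewrite /zelt qeltM !rmorphD !rmorphM. Qed.

Lemma zelt_inj a b c d : zelt a b = zelt c d -> a = c /\ b = d.
Proof. by move=> /qelt_inj[/intr_inj-> /intr_inj->]. Qed.

Lemma zelt_O a b : O (zelt a b).
Proof. by rewrite ring_of_integersE; exists a, b. Qed.

Lemma O_zelt x : O x -> exists a b, x = zelt a b.
Proof. by rewrite ring_of_integersE. Qed.

Lemma zeltM_conj a b : zelt a b * zelt a (- b) = zelt (znorm a b) 0.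
Proof. by rewrite zeltM /znorm; congr zelt; ring. Qed.

Lemma znorm_eq0 a b : znorm a b = 0 -> a = 0 /\ b = 0.
Proof.
have z0 : zelt 0 0 = 0 := zelt0E 0.
move=> N0; have /eqP := zeltM_conj a b.
rewrite N0 z0 mulf_eq0 -z0 => /orP[] /eqP /zelt_inj[-> //].
by move=> /eqP; rewrite oppr_eq0 => /eqP.
Qed.

(** Replaces Euclidean division. The quotient of [zelt a b] by [zelt c d] is [(A + B sqrt D) / N].
    Rounding [t A / N], and approximating [t B / N] to within [1 / D], leaves an error whose norm is
    less than 1 in absolute value. *)
Lemma hurwitz_division (a b c d : int) : (c, d) != (0, 0) ->
  exists (t : nat) (u v x y : int), [/\ (0 < t <= D)%N,
    zelt t 0 * zelt a b - zelt u v * zelt c d = zelt x y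
    & `|znorm x y| < `|znorm c d|].
Proof.
move=> cd0; set N := znorm c d.
have N0 : N != 0.
  by apply: contraNneq cd0 => /znorm_eq0[-> ->].
have D_gt0 : (0 < D)%N by case: (D) D_mod4.
have aN0 : 0 < `|N| by rewrite normr_gt0.
pose A := a * c - D%:Z * b * d; pose B := b * c - a * d.
have [t [k [tD kB]]] := dirichlet_approx B D_gt0 aN0.
pose j := (t%:Z * A %/ `|N|)%Z.
have jA := divz_eq (t%:Z * A) `|N|.
have := ltz_pmod (t%:Z * A) aN0; have := modz_ge0 (t%:Z * A) (lt0r_neq0 aN0).
move: (_ %% _)%Z jA => r; rewrite -/j => jA r0 rN.
pose e := t%:Z * B - k * `|N|.
(* The divisions were by [|N|]; the sign turns them into divisions by [N]. *)
pose u := Num.sg N * j; pose v := Num.sg N * k.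
pose x := t%:Z * a - (u * c + D%:Z * v * d).
pose y := t%:Z * b - (u * d + v * c).
exists t, u, v, x, y; split=> //.
  by rewrite !zeltM zeltB /x /y; congr zelt; ring.
have uN : u * N = j * `|N| by rewrite normrEsg /u; ring.
have vN : v * N = k * `|N| by rewrite normrEsg /v; ring.
(* The remainder times the conjugate of [zelt c d] is [r + e sqrt D]; take norms. *)
have xyN : znorm x y * N = r ^+ 2 - D%:Z * e ^+ 2.
  have -> : r = t%:Z * A - u * N by rewrite uN jA; ring.
  have -> : e = t%:Z * B - v * N by rewrite vN.
  by rewrite /x /y /N /A /B /znorm; ring.
rewrite -(ltr_pM2r aN0) -normrM xyN -expr2.
have r2 : r ^+ 2 < `|N| ^+ 2 by rewrite ltrXn2r.
have e2 : D%:Z * e ^+ 2 < `|N| ^+ 2.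
  apply: (@le_lt_trans _ _ ((`|e| * D%:Z) ^+ 2)).
    rewrite exprMn -normrX ger0_norm ?sqr_ge0 // mulrC ler_wpM2l ?sqr_ge0 //.
    by nia.
  by rewrite ltrXn2r // mulr_ge0.
have r20 := sqr_ge0 r; have e20 : 0 <= D%:Z * e ^+ 2 by rewrite mulr_ge0 ?sqr_ge0.
by rewrite ltr_norml; lia.
Qed.

(** * Fractional ideals and finiteness of the class group *)

Lemma fractional_idealN I x : is_fractional_ideal K I -> I x -> I (- x).
Proof.
move=> [_ _ _ IM _] Ix; rewrite -mulN1r; apply: IM => //.
by have := zelt_O (-1) 0; rewrite zelt0E.
Qed.

Lemma ideal_class_scale I c : K c -> c != 0 ->
  ideal_class K [set c * x | x in I] = ideal_class K I.
Proof.
move=> Kc c0; apply/seteqP; split=> J [e [Ke e0] ->].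
  exists (e * c); first by split; [apply: quadratic_fieldM | rewrite mulf_neq0].
  apply/seteqP; split=> y.
    by move=> [_ [x Ix <-] <-]; exists x; rewrite // mulrA.
  by move=> [x Ix <-]; exists (c * x); [exists x | rewrite mulrA].
exists (e / c).
  split; last by rewrite mulf_neq0 // invr_eq0.
  by apply: quadratic_fieldM => //; apply: quadratic_fieldV.
apply/seteqP; split=> y.
  by move=> [x Ix <-]; exists (c * x); [exists x | rewrite mulrA divfK].
by move=> [_ [x Ix <-] <-]; exists x; rewrite // mulrA divfK.
Qed.

Lemma fractional_ideal_normalize I : is_fractional_ideal K I ->
  exists c, [/\ K c, c != 0, [set c * x | x in I] `<=` O
              & [set c * x | x in I] (D`!)%:R].
Proof.
move=> idI; have [_ [x1 Ix1 x1_neq0] ID IM [d [Od d0] dI]] := idI.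
(* The absolute norms of the nonzero elements of the integral ideal [d I]. *)
pose P k := `[< exists a b x, [/\ (a, b) != (0, 0), I x, d * x = zelt a b
                            & `|znorm a b|%N = k] >].
have exP : exists k, P k.
  have [a [b abE]] := O_zelt (dI _ Ix1).
  exists `|znorm a b|%N; apply/asboolP; exists a, b, x1; split=> //.
  apply/eqP => -[a0 b0]; have := mulf_neq0 d0 x1_neq0.
  by rewrite abE a0 b0 zelt0E eqxx.
have [k /asboolP[b1 [b2 [x0 [b_neq0 Ix0 dx0 <-]]]] kmin] := ex_minnP exP.
set beta := zelt b1 b2 in dx0.
have beta0 : beta != 0.
  apply: contraNneq b_neq0; rewrite -[X in _ = X](zelt0E 0).
  by move=> /zelt_inj[-> ->].
have OK x : O x -> K x by case.
have On (n : nat) : O n%:R.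
  by have := zelt_O n 0; rewrite zelt0E.
have D_gt0 : (0 < D)%N by case: (D) D_mod4.
have m0 : (D`!)%:R != 0 :> algC by rewrite pnatr_eq0 -lt0n fact_gt0.
(* Chosen so that [c x0 = D!], since [d x0 = beta]. *)
pose c := (D`!)%:R * d / beta.
exists c; split.
- apply: quadratic_fieldM; first by apply: quadratic_fieldM; apply: OK.
  by apply: quadratic_fieldV => //; apply/OK/zelt_O.
- by rewrite !mulf_neq0 // invr_eq0.
- move=> _ [x Ix <-].
  have [a [b abE]] := O_zelt (dI _ Ix).
  have [t [u [v [y1 [y2 [tD yE lt_y]]]]]] := hurwitz_division a b b_neq0.
  have Iy : I (t%:R * x - zelt u v * x0).
    apply: ID; first exact: IM.
    by apply: fractional_idealN => //; apply: IM => //; apply: zelt_O.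
  (* A nonzero remainder would contradict the minimality of the norm of [beta]. *)
  have y0 : (y1, y2) = (0, 0).
    apply/eqP; apply: contraTT lt_y => y_neq0.
    rewrite -leNgt -!abszE lez_nat; apply: kmin; apply/asboolP.
    exists y1, y2, (t%:R * x - zelt u v * x0); split=> //.
    have -> : d * (t%:R * x - zelt u v * x0) =
              t%:R * (d * x) - zelt u v * (d * x0) by ring.
    by rewrite abE dx0 -yE zelt0E.
  case: y0 => y10 y20; move: yE; rewrite y10 y20 !zelt0E -abE => /eqP.
  rewrite subr_eq0 => /eqP yE.
  (* As [t <= D], the factor [D!] absorbs [t], whichever [x] it came from. *)
  have [q mE] : exists q, D`! = (q * t)%N by apply/dvdnP; rewrite dvdn_fact.
  have -> : c * x = zelt q 0 * zelt u v.
    rewrite /c mE natrM zelt0E; apply: (mulIf beta0).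
    rewrite -[RHS]mulrA -yE; field => //.
  by rewrite zeltM; apply: zelt_O.
- by exists x0 => //; rewrite /c mulrAC -[_ * d * x0]mulrA dx0 mulfK.
Qed.

(* An ideal of Z[sqrt D] that contains m is determined by its set S of residues
   modulo m, so there are only finitely many such ideals. *)
Definition residue_lift (m : nat) (S : {set 'I_m * 'I_m}) : set algC :=
  [set x | exists p u v,
    p \in S /\ x = zelt (p.1%:Z + m%:Z * u) (p.2%:Z + m%:Z * v)].

Lemma class_group_finite : finite_set (class_group K).
Proof.
set m := D`!.
have m_gt0 : (0 < m)%N by rewrite fact_gt0.
apply: (@sub_finite_set _ _
  [set ideal_class K (residue_lift S) | S in [set: {set 'I_m * 'I_m}]]); last first.
  exact: finite_image.
move=> _ [I idI <-].
have [c [Kc c0 JO Jm]] := fractional_ideal_normalize idI.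
rewrite -(ideal_class_scale _ Kc c0).
have [_ _ ID IM _] := idI.
set J := [set c * x | x in I] in JO Jm *.
have JD x y : J x -> J y -> J (x + y).
  by move=> [x' Ix <-] [y' Iy <-]; exists (x' + y'); [apply: ID | rewrite mulrDr].
have JM a x : O a -> J x -> J (a * x).
  by move=> Oa [x' Ix <-]; exists (a * x'); [apply: IM | rewrite mulrCA].
(* Since [m] is in [J], membership in [J] depends only on coordinates modulo [m]. *)
have J_shift a b u v : J (zelt a b) -> J (zelt (a + m%:Z * u) (b + m%:Z * v)).
  move=> Jab; rewrite -zeltD; apply: JD => //.
  have -> : zelt (m%:Z * u) (m%:Z * v) = zelt u v * m%:R.
    by rewrite -[m%:R]/(m%:Z%:~R) -(zelt0E m) zeltM; congr zelt; ring.
  by apply: JM => //; apply: zelt_O.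
exists (finset (fun p : 'I_m * 'I_m => `[< J (zelt p.1%:Z p.2%:Z) >])) => //.
congr ideal_class; apply/seteqP; split=> x.
  by move=> [p [u [v [+ ->]]]]; rewrite finset.in_set => /asboolP; apply: J_shift.
move=> Jx; have [a [b xE]] := O_zelt (JO _ Jx).
have ord_mod (k : int) : exists (i : 'I_m), k = i%:Z + m%:Z * (k %/ m%:Z)%Z.
  have m_gt0' : 0 < m%:Z by [].
  have k0 := modz_ge0 k (lt0r_neq0 m_gt0'); have km := ltz_pmod k m_gt0'.
  have lt_m : (`|(k %% m%:Z)%Z| < m)%N by lia.
  exists (Ordinal lt_m); rewrite /= gez0_abs //.
  by rewrite {1}(divz_eq k m) addrC [(_ * m%:Z)]mulrC.
have [i aE] := ord_mod a; have [j bE] := ord_mod b.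
exists (i, j), (a %/ m%:Z)%Z, (b %/ m%:Z)%Z; rewrite -aE -bE; split=> //.
rewrite finset.in_set; apply/asboolP => /=.
have -> : i%:Z = a + m%:Z * - (a %/ m%:Z)%Z by rewrite {1}aE; ring.
have -> : j%:Z = b + m%:Z * - (b %/ m%:Z)%Z by rewrite {1}bE; ring.
by apply: J_shift; rewrite -xE.
Qed.

(** * Two distinct ideal classes for even [D] *)

Lemma fractional_ideal_ring_of_integers : is_fractional_ideal K O.
Proof.
have O1 : O 1 by have := zelt_O 1 0; rewrite zelt0E.
split.
- by move=> x [].
- by exists 1; rewrite ?oner_neq0.
- by move=> x y /O_zelt[a [b ->]] /O_zelt[c [d ->]];
    rewrite zeltD; apply: zelt_O.
- by move=> x y /O_zelt[a [b ->]] /O_zelt[c [d ->]];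
    rewrite zeltM; apply: zelt_O.
- by exists 1 => [|x]; rewrite ?mul1r // oner_neq0.
Qed.

(* 2 ramifies when D = 2 mod 4, and this is the prime (2, sqrt D) above it. *)
Definition ideal_above_two : set algC :=
  [set x | exists a b : int, x = zelt (2 * a) b].

Lemma fractional_ideal_above_two :
  ~~ odd D -> is_fractional_ideal K ideal_above_two.
Proof.
move=> /negbTE D_even; have DE : D%:Z = 2 * (D./2)%:Z.
  by rewrite -{1}(odd_double_half D) D_even; lia.
have OK x : O x -> K x by case.
have PO : ideal_above_two `<=` O by move=> _ [a [b ->]]; apply: zelt_O.
have O1 : O 1 by have := zelt_O 1 0; rewrite zelt0E.
split.
- by move=> x /PO/OK.
- exists (zelt (2 * 1) 0); first by exists 1, 0.
  by rewrite zelt0E mulr1 pnatr_eq0.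
- move=> _ _ [a [b ->]] [c [d ->]]; exists (a + c), (b + d).
  by rewrite zeltD mulrDr.
- move=> x _ /O_zelt[a [b ->]] [c [d ->]].
  exists (a * c + (D./2)%:Z * b * d), (a * d + b * (2 * c)).
  by rewrite zeltM DE; congr zelt; ring.
- by exists 1 => [|x /PO]; rewrite ?mul1r // oner_neq0.
Qed.

(** The norm of a generator divides 4 and [- D], the norms of 2 and sqrt D, hence divides
    [gcd(D, 4) = 2]. It is even because the generator lies in the ideal, so it is 2 or -2. *)
Lemma above_two_nonprincipal : ~~ odd D -> (forall x y, `|znorm x y| != 2) ->
  ideal_class K O != ideal_class K ideal_above_two.
Proof.
move=> /negbTE D_even no2; apply/eqP => eq_class.
have K1 : K 1.
  by have [] := zelt_O 1 0; rewrite zelt0E.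
(* The ideal lies in its own class, so equality of the classes makes it [c O]. *)
have : ideal_class K O ideal_above_two.
  rewrite eq_class; exists 1; first by rewrite oner_neq0.
  by apply/seteqP; split=> x; [move=> Px; exists x; rewrite ?mul1r
    | move=> [y Py <-]; rewrite mul1r].
move=> [c _ PE].
have : ideal_above_two c.
  rewrite PE; exists 1; last by rewrite mulr1.
  by have := zelt_O 1 0; rewrite zelt0E.
move=> [a [b cE]].
have norm_dvd x y : ideal_above_two (zelt x y) -> (znorm (2 * a) b %| znorm x y)%Z.
  rewrite PE => -[_ /O_zelt[u [v ->]]].
  rewrite cE zeltM => /zelt_inj[<- <-].
  by apply/dvdzP; exists (znorm u v); rewrite /znorm; ring.
have := no2 (2 * a) b.
have [k kE] : exists k, znorm (2 * a) b = 2 * k.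
  exists (2 * a ^+ 2 - (D./2)%:Z * b ^+ 2); rewrite /znorm.
  have -> : D%:Z = 2 * (D./2)%:Z.
    by rewrite -{1}(odd_double_half D) D_even; lia.
  by ring.
have : (znorm (2 * a) b %| 4)%Z.
  rewrite (_ : 4%Z = znorm (2 * 1) 0); last by rewrite /znorm; lia.
  by apply: norm_dvd; exists 1, 0.
have : (znorm (2 * a) b %| D%:Z)%Z.
  rewrite (_ : D%:Z = - znorm (2 * 0) 1); last by rewrite /znorm; ring.
  by rewrite dvdzE abszN -dvdzE; apply: norm_dvd; exists 0, 1.
rewrite kE !dvdzE => kD k4.
have : (`|(2 * k)%R| %| 2)%N.
  have gcdD4 : gcdn D 4 = 2%N.
    have D4 : (D %% 4 = 2)%N by move: D_mod4 D_even; lia.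
    by rewrite -gcdn_modl D4.
  by rewrite -[X in (_ %| X)%N]gcdD4 dvdn_gcd; apply/andP.
rewrite abszM -[X in (_ %| X)%N](muln1 2) (@dvdn_pmul2l 2) // dvdn1 => /eqP k1.
by rewrite -abszE abszM k1.
Qed.

Lemma class_number_gt1 : ~~ odd D -> (forall x y, `|znorm x y| != 2) ->
  (1 < h D)%N.
Proof.
move=> D_even no2.
have neq := above_two_nonprincipal D_even no2.
apply: leq_trans (fsubset_leq_card
  (_ : [fset ideal_class K O; ideal_class K ideal_above_two] `<=` _)%fset).
  by rewrite cardfs2 neq.
apply/fsubsetP => C; rewrite !in_fsetE in_fset_set; last exact: class_group_finite.
by move=> /orP[] /eqP ->; rewrite inE; [exists O | exists ideal_above_two] => //;
  [apply: fractional_ideal_ring_of_integers | apply: fractional_ideal_above_two].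
Qed.

End QuadraticField.

End RealQuadraticFields.

Theorem corollary1p6 (n : nat) (n_odd : odd n) (n_ge : 931 <= n)
  (D_squarefree : squarefree (n ^ 2 + 1)) : 1 < h (n ^ 2 + 1).
Proof.
apply: class_number_gt1 => //.
(* An odd square is 1 modulo 4, so [n ^ 2 + 1] is 2 modulo 4. *)
- have [m ->] : exists m, n = 2 * m + 1 by exists n./2; lia.
  have -> : (2 * m + 1) ^ 2 + 1 = (m ^ 2 + m) * 4 + 2 by lia.
  by rewrite modnMDl.
- by rewrite addn1 /= oddX n_odd.
- by move=> x y; apply: pell_neq2; apply: leq_trans n_ge.
Qed.
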